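(* For $p+q\ge4$, there is an isomorphism of graded vector spaces $$H^*_{\mathrm{Lie}}(\mathfrak h_{p,q};\mathbf R)\cong H^*_{\mathrm{Lie}}(\mathfrak{so}(p,q);\mathbf R)\otimes(\mathbf R\oplus\langle v^*\rangle),$$ where $v^*=dx^1\wedge dx^2\wedge\cdots\wedge dx^n$ has degree $n$ and $\mathbf R$ sits in degree $0$.
   Context: Let $p,q$ be nonnegative integers, $n=p+q$. On $\mathbf R^n$ write $\partial_i=\partial/\partial x^i$; $\alpha_{ij}=x_i\partial_j-x_j\partial_i$ ($1\le i<j\le p$ or $p+1\le i<j\le n$), $\beta_{ij}=x_i\partial_j+x_j\partial_i$ ($1\le i\le p<j\le n$). Their span is identified with $\mathfrak{so}(p,q)$; $\mathfrak I_n=\mathrm{span}\{\partial_i\}$; $\mathfrak h_{p,q}$ is the Lie algebra of vector fields with basis $\{\alpha_{ij}\}\cup\{\beta_{ij}\}\cup\{\partial_i\}$. $dx^i$ denotes the linear functional on $\mathfrak h_{p,q}$ dual to $\partial_i$ with respect to this basis (vanishing on all $\alpha_{ij},\beta_{ij}$ and on $\partial_j$, $j\neq i$). $H^*_{\mathrm{Lie}}(\cdot;\mathbf R)$ is Chevalley–Eilenberg cohomology with trivial coefficients. *)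

(* Defs.v *)
From Stdlib Require Import Reals.
From HB Require Import structures.
From mathcomp Require Import all_boot all_order all_algebra.
From mathcomp Require Import Rstruct.

Set Implicit Arguments.
Unset Strict Implicit.
Unset Printing Implicit Defensive.

Import Order.TTheory GRing.Theory Num.Theory.
Local Open Scope ring_scope.

(* Chevalley--Eilenberg cohomology with trivial coefficients of a finite-   *)
(* dimensional Lie algebra g over a field F, given by a basis indexed by a  *)
(* finite type I and its structure constants:  [e_u, e_v] = sum_w c u v w e_w. *)
(* A k-cochain is an alternating k-form on g; it is determined by its values *)
(* on increasing k-tuples of basis vectors, i.e. on k-subsets of I (ordered *)
(* by enum_rank).  We store all cochains of all degrees in                  *)
(*   C = {ffun {set I} -> F^o}, degree = cardinality of the subset.         *)
Section CE.
Variables (F : fieldType) (I : finType) (c : I -> I -> I -> F).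

Definition ltI (x y : I) : bool := (val (enum_rank x) < val (enum_rank y))%N.

Definition pos (T : {set I}) (m : I) : nat := #|[set y in T | ltI y m]|.

Definition cochains := {ffun {set I} -> F^o}.

(* f(e_m, e_{t_1}, ..., e_{t_r}) for T = {t_1 < ... < t_r} *)
Definition ins (f : cochains) (m : I) (T : {set I}) : F :=
  if m \in T then 0 else (-1) ^+ (pos T m) * f (m |: T).

(* (df)(e_{s_0},...,e_{s_k}) =
     sum_{a<b} (-1)^(a+b) f([e_{s_a}, e_{s_b}], e_{s_0}, ..^..^.., e_{s_k}) *)
Definition CEd_fun (f : cochains) : cochains :=
  [ffun A : {set I} =>
     \sum_(s in A) \sum_(t in A | ltI s t)
        (-1) ^+ (pos A s + pos A t) *
        \sum_(m : I) c s t m * ins f m (A :\ s :\ t)].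

Definition CEd : 'End(cochains) := linfun CEd_fun.

Definition delta (A : {set I}) : cochains := [ffun B => (B == A)%:R].

Definition Cdeg (k : nat) : {vspace cochains} :=
  <<[seq delta A | A <- enum [set A : {set I} | #|A| == k]]>>%VS.

Definition cocycles (k : nat) : {vspace cochains} := (Cdeg k :&: lker CEd)%VS.
Definition coboundaries (k : nat) : {vspace cochains} :=
  if k is k'.+1 then (CEd @: Cdeg k')%VS else 0%VS.

Definition Hdim (k : nat) : nat := (\dim (cocycles k) - \dim (coboundaries k))%N.

End CE.

(* The Lie algebra h_{p,q} of affine vector fields on R^n, n = p+q.          *)
(* An affine vector field x |-> a + M x is represented by (a, M); the bracket *)
(* of vector fields [V,W]^k = V^l d_l W^k - W^l d_l V^k gives                 *)
(*   [(a,M),(b,N)] = (N a - M b, N M - M N).                                 *)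
(* Coordinates are 0..n-1 (x^1..x^p are indices 0..p-1).                     *)
Definition afield (n : nat) := ('cV[R]_n * 'M[R]_n)%type.

Definition afbr (n : nat) (V W : afield n) : afield n :=
  (W.2 *m V.1 - V.2 *m W.1, W.2 *m V.2 - V.2 *m W.2).

Definition pairI (n : nat) := {ij : 'I_n * 'I_n | (ij.1 < ij.2)%N}.

Definition sameblock (p n : nat) (i j : 'I_n) : bool := ((i < p)%N == (j < p)%N).

(* alpha_ij = x_i d_j - x_j d_i (same block), beta_ij = x_i d_j + x_j d_i *)
Definition soBasis (p n : nat) (ij : pairI n) : 'M[R]_n :=
  let i := (val ij).1 in let j := (val ij).2 in
  \matrix_(k, l) (if (k == j) && (l == i) then 1
                  else if (k == i) && (l == j) then
                         (if sameblock p i j then -1 else 1)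
                  else 0).

Definition hIndex (n : nat) := (pairI n + 'I_n)%type.

Definition hBasis (p n : nat) (u : hIndex n) : afield n :=
  match u with
  | inl ij => (0, soBasis p ij)
  | inr i => (\col_(k < n) (if k == i then 1 else 0), 0)
  end.

(* dual coordinate functionals w.r.t. this basis (on the span):
   coefficient of alpha_ij/beta_ij is M j i, coefficient of d_i (= dx^i) is a i *)
Definition hCoord (n : nat) (w : hIndex n) (V : afield n) : R :=
  match w with
  | inl ij => V.2 (val ij).2 (val ij).1
  | inr i => V.1 i 0
  end.

Definition h_c (p q : nat) (u v w : hIndex (p + q)) : R :=
  hCoord w (afbr (hBasis p u) (hBasis p v)).
Arguments h_c : clear implicits.

Definition so_c (p q : nat) (u v w : pairI (p + q)) : R :=
  h_c p q (inl u) (inl v) (inl w).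
Arguments so_c : clear implicits.

(* Main.v *)
(* The algebra h is the semidirect product of so(p,q) and the abelian ideal
   R^n, so its Chevalley--Eilenberg complex splits according to the number j
   of factors dx^i; the j-th summand is the complex of so(p,q) with
   coefficients in Lambda^j (R^n)^*.  For j = 0 and j = n these coefficients
   are trivial (matrices in so(p,q) have zero diagonal), which gives the two
   copies of H^*(so(p,q)).  For 0 < j < n the summand is acyclic: if (e_s) is
   the given basis of so(p,q), which is orthogonal for the trace form,
   kappa_s = - tr(e_s^2) / 2 = 1 or -1, iota_s is the contraction with e_s and
   X_s the action of e_s on the dx^i alone, then H = sum_s kappa_s X_s iota_s
   satisfies dH + Hd = - sum_s kappa_s X_s^2, a Casimir operator, which is the
   nonzero scalar j(n - j) on Lambda^j. *)

Require Import Defs.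
From Stdlib Require Import Reals.
From HB Require Import structures.
From mathcomp Require Import all_boot all_order all_algebra.
From mathcomp Require Import Rstruct zify ring lra.

Set Implicit Arguments.
Unset Strict Implicit.
Unset Printing Implicit Defensive.

Import Order.TTheory GRing.Theory Num.Theory.
Local Open Scope ring_scope.

(** * The differential in an algebra with canonical anticommutation relations *)

Lemma eq_opp_eq0 (F : numFieldType) (V : lmodType F) (x : V) : x = - x -> x = 0.
Proof.
move=> h; have: (2%:R : F) *: x == 0 by rewrite scaler_nat mulr2n {2}h subrr.
by rewrite scaler_eq0 pnatr_eq0 /= => /eqP.
Qed.

(* [e i] and [a i] stand for the exterior product with the i-th dual basis
   covector and the contraction with the i-th basis vector; only their
   anticommutation relations matter.  [Dop] is -2 times the differential
   (see [CEd_Dop]) and [Lop x] is minus the Lie derivative along x. *)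
Section Fermions.
Variables (F : numFieldType) (A : algType F) (I : finType).
Variables (e a : I -> A) (c : I -> I -> I -> F).
Hypothesis e_e : forall i j, e i * e j = - (e j * e i).
Hypothesis a_a : forall i j, a i * a j = - (a j * a i).
Hypothesis a_e : forall i j, a i * e j = (i == j)%:R - e j * a i.
Hypothesis c_anti : forall u v w, c u v w = - c v u w.
Hypothesis c_jacobi : forall u v x z,
  \sum_w (c u v w * c w x z + c v x w * c w u z + c x u w * c w v z) = 0.

(** [qf w] is -2 times the differential of the w-th dual covector; [lf w z] is the z-th dual
    covector composed with the bracket by the w-th basis vector. *)
Definition qf (w : I) : A := \sum_u \sum_v c u v w *: (e u * e v).
Definition lf (w z : I) : A := \sum_v c w v z *: e v.
Definition Dop : A := \sum_w qf w * a w.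
Definition Lop (x : I) : A := \sum_w lf x w * a w.

Lemma e_ee i u v : e i * (e u * e v) = e u * e v * e i.
Proof. by rewrite mulrA (e_e i u) mulNr -(mulrA (e u) (e i)) (e_e i v) mulrN opprK mulrA. Qed.

Lemma e_qf i w : e i * qf w = qf w * e i.
Proof.
rewrite /qf mulr_sumr mulr_suml; apply: eq_bigr => u _.
rewrite mulr_sumr mulr_suml; apply: eq_bigr => v _.
by rewrite -scalerAr e_ee scalerAl.
Qed.

Lemma qf_qf w z : qf w * qf z = qf z * qf w.
Proof.
rewrite {1 4}/qf mulr_sumr mulr_suml; apply: eq_bigr => u _.
rewrite mulr_sumr mulr_suml; apply: eq_bigr => v _.
by rewrite -scalerAr -scalerAl mulrA -e_qf -mulrA -e_qf mulrA.
Qed.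

(** The contraction passes both factors of each quadratic monomial, and antisymmetry of [c] makes
    the two resulting linear terms equal. *)
Lemma a_qf w z : a w * qf z = qf z * a w + lf w z *+ 2.
Proof.
have -> : lf w z *+ 2 = \sum_u \sum_v
    (((w == u)%:R * c u v z) *: e v - ((w == v)%:R * c u v z) *: e u).
  under eq_bigr => u _ do rewrite sumrB.
  rewrite sumrB mulr2n; congr (_ + _).
    rewrite (bigD1 w) //= [X in _ + X]big1 ?addr0 => [|u /negPf uw].
      by apply: eq_bigr => v _; rewrite eqxx mul1r.
    by apply: big1 => v _; rewrite eq_sym uw mul0r scale0r.
  rewrite exchange_big (bigD1 w) //= [X in _ + X]big1 ?addr0 => [|u /negPf uw].
    by rewrite -sumrN; apply: eq_bigr => v _; rewrite eqxx mul1r c_anti scaleNr.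
  by apply: big1 => v _; rewrite eq_sym uw mul0r scale0r.
rewrite /qf mulr_sumr mulr_suml -big_split; apply: eq_bigr => u _ /=.
rewrite mulr_sumr mulr_suml -big_split; apply: eq_bigr => v _ /=.
rewrite -scalerAr mulrA a_e mulrBl -(mulrA _ (a w)) a_e mulrBr opprB mulrA.
rewrite addrCA scalerDr -scalerAl scalerBr; congr (_ + (_ - _)).
- by case: (w == u); rewrite ?mul1r // !mul0r scaler0 scale0r.
by case: (w == v); rewrite ?mulr1 ?mul1r // mulr0 mul0r scaler0 scale0r.
Qed.

(** A cyclic rotation of three covectors is even, so the sum equals both of its rotations. The three
    coefficients add up to the Jacobi identity, and 3 is invertible. *)
Lemma sum_qf_lf z : \sum_w qf w * lf w z = 0.
Proof.
pose t u v x := \sum_w c u v w * c w x z.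
have E : \sum_w qf w * lf w z =
    \sum_u \sum_v \sum_x t u v x *: (e u * e v * e x).
  rewrite /qf.
  under eq_bigr => w _.
    rewrite mulr_suml.
    under eq_bigr => u _.
      rewrite mulr_suml.
      under eq_bigr => v _.
        rewrite /lf mulr_sumr.
        under eq_bigr => x _ do rewrite -scalerAl -scalerAr scalerA.
        over.
      over.
    over.
  rewrite exchange_big; apply: eq_bigr => u _ /=.
  rewrite exchange_big; apply: eq_bigr => v _ /=.
  rewrite exchange_big; apply: eq_bigr => x _ /=.
  by rewrite -scaler_suml.
have rot (G : I -> I -> I -> A) :
    \sum_u \sum_v \sum_x G u v x = \sum_u \sum_v \sum_x G v x u.
  rewrite [RHS]exchange_big; apply: eq_bigr => v _.
  by rewrite exchange_big.
have e3 u v x : e v * e x * e u = e u * e v * e x by rewrite -e_ee mulrA.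
have E1 : \sum_w qf w * lf w z =
    \sum_u \sum_v \sum_x t v x u *: (e u * e v * e x).
  rewrite E rot; apply: eq_bigr => u _; apply: eq_bigr => v _.
  by apply: eq_bigr => x _; rewrite e3.
have E2 : \sum_w qf w * lf w z =
    \sum_u \sum_v \sum_x t x u v *: (e u * e v * e x).
  rewrite E1 rot; apply: eq_bigr => u _; apply: eq_bigr => v _.
  by apply: eq_bigr => x _; rewrite e3.
have : (3%:R : F) *: (\sum_w qf w * lf w z) == 0.
  rewrite scaler_nat !mulrS mulr0n addr0 {1}E {1}E1 E2 -!big_split /=.
  apply/eqP; apply: big1 => u _; rewrite -!big_split; apply: big1 => v _ /=.
  rewrite -!big_split; apply: big1 => x _ /=.
  rewrite -!scalerDl addrA -!big_split /=.
  by rewrite c_jacobi scale0r.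
by rewrite scaler_eq0 pnatr_eq0 => /eqP.
Qed.

(** Reordering leaves a term that vanishes by the Jacobi identity and a double contraction. Swapping
    the two indices turns the latter into its negative, because the [qf w] commute and the [a w]
    anticommute. *)
Lemma Dop_sqr : Dop * Dop = 0.
Proof.
have -> : Dop * Dop =
    \sum_w \sum_z qf w * qf z * (a w * a z) + (\sum_z (\sum_w qf w * lf w z) * a z) *+ 2.
  rewrite {1}/Dop mulr_suml.
  under [X in X *+ 2]eq_bigr do rewrite mulr_suml.
  rewrite [X in X *+ 2]exchange_big -sumrMnl -big_split; apply: eq_bigr => w _ /=.
  rewrite /Dop mulr_sumr -sumrMnl -big_split; apply: eq_bigr => z _ /=.
  by rewrite mulrA -(mulrA (qf w)) a_qf mulrDr mulrDl !mulrA mulrnAr mulrnAl.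
rewrite [X in _ + X *+ 2]big1 => [|z _]; last by rewrite sum_qf_lf mul0r.
rewrite mul0rn addr0; apply: eq_opp_eq0.
rewrite {1}exchange_big -sumrN; apply: eq_bigr => w _ /=.
by rewrite -sumrN; apply: eq_bigr => z _; rewrite a_a mulrN qf_qf.
Qed.

(** Cartan's formula for the Lie derivative, in the normalisations of [Dop] and [Lop]. *)
Lemma Dop_a x : Dop * a x + a x * Dop = Lop x *+ 2.
Proof.
rewrite /Dop mulr_suml mulr_sumr /Lop -sumrMnl -big_split; apply: eq_bigr => w _ /=.
by rewrite mulrA a_qf mulrDl -!mulrA (a_a w x) mulrN mulrA addKr mulrnAl.
Qed.

Lemma Dop_e x : Dop * e x + e x * Dop = qf x.
Proof.
rewrite /Dop mulr_suml mulr_sumr -big_split (bigD1 x) //= [X in _ + X]big1 => [|w /negPf wx].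
  by rewrite mulrA e_qf -!mulrA a_e eqxx mulrBr mulr1 subrK addr0.
by rewrite mulrA e_qf -!mulrA a_e wx sub0r mulrN addNr.
Qed.

Lemma Dop_ea i j : Dop * (e i * a j) - e i * a j * Dop = qf i * a j - (e i * Lop j) *+ 2.
Proof.
by rewrite -Dop_e mulrDl -mulrnAr -Dop_a mulrDr !mulrA opprD addrA addrK.
Qed.

End Fermions.

(** * The homotopy of a semidirect product and the Casimir operator *)

Section Casimir.
Variables (F : numFieldType) (A : algType F) (S T : finType).
Notation I := (S + T)%type.
Variables (e a : I -> A) (c : I -> I -> I -> F) (kappa : S -> F).
Hypothesis e_e : forall i j, e i * e j = - (e j * e i).
Hypothesis a_a : forall i j, a i * a j = - (a j * a i).
Hypothesis a_e : forall i j, a i * e j = (i == j)%:R - e j * a i.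
Hypothesis c_anti : forall u v w, c u v w = - c v u w.
Hypothesis c_jacobi : forall u v x z,
  \sum_w (c u v w * c w x z + c v x w * c w u z + c x u w * c w v z) = 0.
(** [S] indexes a basis of a subalgebra and [T] one of a complementary abelian ideal. [kappa_inv]
    expresses invariance of the sum of kappa_s e_s tensor e_s under the subalgebra. *)
Hypothesis c_SST : forall s t k, c (inl s) (inl t) (inr k) = 0.
Hypothesis c_STS : forall s i r, c (inl s) (inr i) (inl r) = 0.
Hypothesis c_TT : forall i j w, c (inr i) (inr j) w = 0.
Hypothesis kappa_inv : forall s b r,
  kappa s * c (inl s) (inl b) (inl r) + kappa r * c (inl r) (inl b) (inl s) = 0.

(** The part of [Lop] at [inl s] that acts on the covectors of the ideal. *)
Definition Xop (s : S) : A :=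
  \sum_i \sum_j c (inl s) (inr i) (inr j) *: (e (inr i) * a (inr j)).

Definition Hop : A := \sum_s kappa s *: (Xop s * a (inl s)).

Lemma LopE x : Lop e a c x = \sum_v \sum_w c x v w *: (e v * a w).
Proof.
rewrite exchange_big; apply: eq_bigr => w _ /=.
by rewrite /lf mulr_suml; apply: eq_bigr => v _; rewrite scalerAl.
Qed.

Lemma c_TSS i s r : c (inr i) (inl s) (inl r) = 0.
Proof. by rewrite c_anti c_STS oppr0. Qed.

Lemma qf_T i : qf e c (inr i) =
  (\sum_b \sum_k c (inl b) (inr k) (inr i) *: (e (inl b) * e (inr k))) *+ 2.
Proof.
rewrite /qf big_sumType /= mulr2n; congr (_ + _).
  apply: eq_bigr => b _; rewrite big_sumType /= big1 ?add0r // => s _.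
  by rewrite c_SST scale0r.
rewrite exchange_big big_sumType /= [X in _ + X]big1 ?addr0 => [|k _].
  apply: eq_bigr => b _; apply: eq_bigr => k _.
  by rewrite c_anti e_e scaleNr scalerN opprK.
by rewrite big1 // => j _; rewrite c_TT scale0r.
Qed.

Lemma Lop_T j : Lop e a c (inr j) =
  - \sum_b \sum_k c (inl b) (inr j) (inr k) *: (e (inl b) * a (inr k)).
Proof.
rewrite LopE big_sumType /= [X in _ + X]big1 ?addr0 => [|k _]; last first.
  by rewrite big1 // => w _; rewrite c_TT scale0r.
rewrite -sumrN; apply: eq_bigr => b _.
rewrite big_sumType /= big1 ?add0r => [|s _]; last by rewrite c_TSS scale0r.
by rewrite -sumrN; apply: eq_bigr => k _; rewrite c_anti scaleNr.
Qed.

Lemma Lop_S s : Lop e a c (inl s) =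
  \sum_b \sum_r c (inl s) (inl b) (inl r) *: (e (inl b) * a (inl r)) + Xop s.
Proof.
rewrite LopE big_sumType /=; congr (_ + _); apply: eq_bigr => i _.
  rewrite big_sumType /= [X in _ + X]big1 ?addr0 // => k _.
  by rewrite c_SST scale0r.
rewrite big_sumType /= big1 ?add0r // => r _.
by rewrite c_STS scale0r.
Qed.

Lemma X_e s b : Xop s * e (inl b) = e (inl b) * Xop s.
Proof.
rewrite mulr_suml mulr_sumr; apply: eq_bigr => i _.
rewrite mulr_suml mulr_sumr; apply: eq_bigr => j _.
rewrite -scalerAl -scalerAr -mulrA a_e /= sub0r mulrN !mulrA.
by rewrite (e_e (inl b)) mulNr.
Qed.

(** The ideal component of the Jacobi identity for two elements of the subalgebra and one of the
    ideal: the ideal is a representation. *)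
Lemma jacobi_rep s b k j :
  \sum_i c (inl b) (inr k) (inr i) * c (inl s) (inr i) (inr j) -
  \sum_i c (inl s) (inr k) (inr i) * c (inl b) (inr i) (inr j) =
  \sum_r c (inl s) (inl b) (inl r) * c (inl r) (inr k) (inr j).
Proof.
have := c_jacobi (inl s) (inl b) (inr k) (inr j).
rewrite big_sumType /=.
under eq_bigr => r _ do rewrite c_STS c_TSS !mul0r !addr0.
under [X in _ + X]eq_bigr => i _.
  rewrite c_SST mul0r add0r (c_anti (inr i) (inl s)) mulrN.
  rewrite (c_anti (inr k) (inl s)) (c_anti (inr i) (inl b)) mulrNN.
  over.
rewrite big_split sumrN /= => /eqP.
by rewrite addr_eq0 opprD opprK => /eqP ->; rewrite addrC.
Qed.

(** The commutator with each e_i a_j produces products of two matrices of the representation. They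
    assemble into a matrix commutator, which [jacobi_rep] replaces by the matrix of the bracket. *)
Lemma Dop_X s : Dop e a c * Xop s - Xop s * Dop e a c =
  (\sum_b e (inl b) * \sum_r c (inl s) (inl b) (inl r) *: Xop r) *+ 2.
Proof.
pose m b k j := e (inl b) * (e (inr k) * a (inr j)).
have -> : \sum_b e (inl b) * \sum_r c (inl s) (inl b) (inl r) *: Xop r =
  \sum_b \sum_k \sum_j
   (\sum_i c (inl b) (inr k) (inr i) * c (inl s) (inr i) (inr j) -
    \sum_i c (inl s) (inr k) (inr i) * c (inl b) (inr i) (inr j)) *: m b k j.
  apply: eq_bigr => b _; rewrite mulr_sumr.
  transitivity (\sum_r \sum_k \sum_j
     (c (inl s) (inl b) (inl r) * c (inl r) (inr k) (inr j)) *: m b k j).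
    apply: eq_bigr => r _; rewrite -scalerAr /Xop mulr_sumr scaler_sumr.
    apply: eq_bigr => k _; rewrite mulr_sumr scaler_sumr.
    by apply: eq_bigr => j _; rewrite -scalerAr scalerA.
  rewrite exchange_big; apply: eq_bigr => k _ /=.
  rewrite exchange_big; apply: eq_bigr => j _ /=.
  by rewrite jacobi_rep scaler_suml.
have P i j : Dop e a c * (e (inr i) * a (inr j)) - e (inr i) * a (inr j) * Dop e a c =
   (\sum_b \sum_k (c (inl b) (inr k) (inr i) *: m b k j -
                  c (inl b) (inr j) (inr k) *: m b i k)) *+ 2.
  rewrite Dop_ea // qf_T Lop_T mulrN mulNrn opprK mulrnAl -mulrnDl; congr (_ *+ 2).
  rewrite mulr_suml mulr_sumr -big_split; apply: eq_bigr => b _ /=.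
  rewrite mulr_suml mulr_sumr -big_split; apply: eq_bigr => k _ /=.
  rewrite -scalerAl -scalerAr mulrA (e_e (inr i)) mulNr scalerN /m !mulrA.
  by [].
rewrite {1 2}/Xop mulr_sumr mulr_suml -sumrB.
transitivity (\sum_i \sum_j c (inl s) (inr i) (inr j) *:
   ((\sum_b \sum_k (c (inl b) (inr k) (inr i) *: m b k j -
                  c (inl b) (inr j) (inr k) *: m b i k)) *+ 2)).
  apply: eq_bigr => i _; rewrite mulr_sumr mulr_suml -sumrB.
  by apply: eq_bigr => j _; rewrite -scalerAl -scalerAr -scalerBr P.
under eq_bigr => i _.
  under eq_bigr => j _.
    rewrite -scalerMnr scaler_sumr.
    under eq_bigr => b _.
      rewrite scaler_sumr.
      under eq_bigr => k _ do rewrite scalerBr !scalerA.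
      rewrite sumrB.
      over.
    rewrite sumrB.
    over.
  rewrite sumrMnl sumrB.
  over.
rewrite sumrMnl sumrB; congr (_ *+ 2).
(* Reindexing each half so that the contracted index is summed innermost exhibits the two matrix
   products. *)
transitivity (\sum_b \sum_k \sum_j
   ((\sum_i c (inl b) (inr k) (inr i) * c (inl s) (inr i) (inr j)) *: m b k j) -
   \sum_b \sum_k \sum_j
    ((\sum_i c (inl s) (inr k) (inr i) * c (inl b) (inr i) (inr j)) *: m b k j));
  last first.
  rewrite -sumrB; apply: eq_bigr => b _; rewrite -sumrB; apply: eq_bigr => k _.
  by rewrite -sumrB; apply: eq_bigr => j _; rewrite scalerBl.
congr (_ - _).
  under eq_bigr => i _ do rewrite exchange_big.
  rewrite exchange_big; apply: eq_bigr => b _ /=.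
  under eq_bigr => i _ do rewrite exchange_big.
  rewrite exchange_big; apply: eq_bigr => k _ /=.
  rewrite exchange_big; apply: eq_bigr => j _ /=.
  by rewrite scaler_suml; apply: eq_bigr => i _; rewrite mulrC.
under eq_bigr => i _ do rewrite exchange_big.
rewrite exchange_big; apply: eq_bigr => b _ /=.
apply: eq_bigr => k _ /=.
rewrite exchange_big; apply: eq_bigr => j _ /=.
by rewrite scaler_suml; apply: eq_bigr => i _.
Qed.

(** By the Leibniz rule each summand gives [D, X_s] a_s + X_s (D a_s + a_s D). Apart from the
    squares X_s X_s, the two kinds of terms are exchanged by swapping r and s, and cancel by
    invariance of [kappa]. *)
Lemma Dop_Hop : Dop e a c * Hop + Hop * Dop e a c =
  (\sum_s kappa s *: (Xop s * Xop s)) *+ 2.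
Proof.
pose m b r s := e (inl b) * (Xop r * a (inl s)).
transitivity (\sum_s kappa s *: ((Dop e a c * Xop s - Xop s * Dop e a c) * a (inl s) +
   Xop s * (Dop e a c * a (inl s) + a (inl s) * Dop e a c))).
  rewrite /Hop mulr_sumr mulr_suml -big_split; apply: eq_bigr => s _ /=.
  rewrite -scalerAl -scalerAr -scalerDr; congr (_ *: _).
  by rewrite mulrBl mulrDr !mulrA addrA subrK.
transitivity (\sum_s (\sum_b \sum_r (kappa s * c (inl s) (inl b) (inl r)) *: m b r s +
  \sum_b \sum_r (kappa s * c (inl s) (inl b) (inl r)) *: m b s r +
   kappa s *: (Xop s * Xop s)) *+ 2).
  apply: eq_bigr => s _; rewrite Dop_X Dop_a // Lop_S mulrnAl mulrnAr -mulrnDl.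
  rewrite -scalerMnr mulrDr addrA !scalerDr; congr ((_ + _ + _) *+ 2).
    rewrite mulr_suml scaler_sumr; apply: eq_bigr => b _.
    rewrite -mulrA mulr_suml mulr_sumr scaler_sumr; apply: eq_bigr => r _.
    by rewrite -scalerAl -scalerAr scalerA.
  rewrite mulr_sumr scaler_sumr; apply: eq_bigr => b _.
  rewrite mulr_sumr scaler_sumr; apply: eq_bigr => r _.
  by rewrite -scalerAr scalerA mulrA X_e -mulrA.
rewrite sumrMnl !big_split /=; congr (_ *+ 2).
rewrite -[RHS]add0r; congr (_ + _).
rewrite exchange_big [X in _ + X]exchange_big -big_split big1 // => b _ /=.
rewrite exchange_big -big_split big1 //= => s _.
rewrite -big_split big1 //= => r _.
by rewrite -scalerDl kappa_inv scale0r.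
Qed.

End Casimir.

(** * Signs attached to positions in an ordered set *)

Section Position.
Variables (F : fieldType) (I : finType).
Implicit Types (i j : I) (T : {set I}).

Definition sg T i : F := (-1) ^+ Defs.pos T i.

Lemma ltI_irr i : ltI i i = false.
Proof. by rewrite /ltI ltnn. Qed.

Lemma ltI_neg i j : i != j -> ltI j i = ~~ ltI i j.
Proof.
move=> ij; rewrite /ltI -leqNgt ltn_neqAle.
suff -> : val (enum_rank j) != val (enum_rank i) by [].
by rewrite (inj_eq val_inj) (inj_eq enum_rank_inj) eq_sym.
Qed.

Lemma sg_sqr T i : sg T i * sg T i = 1.
Proof. by rewrite /sg -expr2 sqrr_sign. Qed.

Lemma sgU T i j : i \notin T -> sg (i |: T) j = (-1) ^+ ltI i j * sg T j.
Proof.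
move=> iT; rewrite /sg -exprD; congr (_ ^+ _); rewrite /Defs.pos.
rewrite (cardsD1 i) inE setU11 /=; congr (_ + _)%N; apply: eq_card => y.
rewrite !inE; case: eqVneq => //= ->.
by rewrite (negbTE iT).
Qed.

Lemma sgD T i j : i \in T -> sg (T :\ i) j = (-1) ^+ ltI i j * sg T j.
Proof.
move=> iT; rewrite -{2}(setD1K iT) sgU ?setD11 //.
by rewrite mulrA -expr2 sqrr_sign mul1r.
Qed.

End Position.

(** * Exterior multiplication and contraction on cochains *)

Section Fock.
Variables (F : fieldType) (I : finType).
Notation V := (cochains F I).
Implicit Types (i j : I) (A : {set I}) (f : V).

Definition contr_fun i f : V := [ffun A : {set I} => ins f i A].
Definition wedge_fun i f : V :=
  [ffun A : {set I} => if i \in A then sg F A i * f (A :\ i) else 0].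

Fact contr_fun_linear i : linear (contr_fun i).
Proof.
move=> x f g; apply/ffunP => A; rewrite !ffunE /ins.
by case: ifP => _; rewrite ?scaler0 ?addr0 // ?ffunE ?mulrDr ?scalerAr.
Qed.

Fact wedge_fun_linear i : linear (wedge_fun i).
Proof.
move=> x f g; apply/ffunP => A; rewrite !ffunE.
by case: ifP => _; rewrite ?scaler0 ?addr0 // ?ffunE ?mulrDr ?scalerAr.
Qed.

HB.instance Definition _ i := GRing.isLinear.Build F V V *:%R (contr_fun i) (contr_fun_linear i).
HB.instance Definition _ i := GRing.isLinear.Build F V V *:%R (wedge_fun i) (wedge_fun_linear i).

Definition contr i : 'End(V) := linfun (contr_fun i).
Definition wedge i : 'End(V) := linfun (wedge_fun i).

Lemma contrE i f A : contr i f A = ins f i A.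
Proof. by rewrite lfunE ffunE. Qed.

Lemma wedgeE i f A : wedge i f A = if i \in A then sg F A i * f (A :\ i) else 0.
Proof. by rewrite lfunE ffunE. Qed.

(** Removing i first changes the sign at j exactly when i precedes j, and conversely; for distinct i
    and j exactly one of these happens. *)
Lemma wedge_wedge i j : (wedge i \o wedge j = - (wedge j \o wedge i))%VF.
Proof.
apply/lfunP => f; apply/ffunP => A; rewrite opp_lfunE !comp_lfunE ffunE !wedgeE !inE.
have [->|ij] := eqVneq i j.
  by rewrite /= mulr0 if_same oppr0.
rewrite /=; case: ifP => iA; case: ifP => jA //=;
  rewrite ?mulr0 ?oppr0 //.
rewrite !sgD // (ltI_neg ij) setDDl setUC -setDDl.
by case: ltI; rewrite ?expr1 ?expr0 !(mul1r, mulN1r, mulNr, mulrN) ?opprK !mulrA (mulrC (sg _ _ i)).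
Qed.

Lemma contr_contr i j : (contr i \o contr j = - (contr j \o contr i))%VF.
Proof.
apply/lfunP => f; apply/ffunP => A; rewrite opp_lfunE !comp_lfunE ffunE !contrE /ins !contrE /ins !inE.
have [->|ij] := eqVneq i j.
  by rewrite /= mulr0 if_same oppr0.
rewrite /=; case: (boolP (i \in A)) => iA; case: (boolP (j \in A)) => jA //=;
  rewrite ?mulr0 ?oppr0 //.
rewrite -/(sg F _ _) -/(sg F _ _) -/(sg F _ _) -/(sg F _ _) !sgU // (ltI_neg ij) setUCA.
by case: ltI; rewrite ?expr1 ?expr0 !(mul1r, mulN1r, mulNr, mulrN) ?opprK !mulrA (mulrC (sg _ _ i)).
Qed.

(** For i = j exactly one of the two compositions acts as the identity on the value at A and the
    other gives 0, according to whether A contains i. *)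
Lemma contr_wedge i j : (contr i \o wedge j = (i == j)%:R *: \1 - (wedge j \o contr i))%VF.
Proof.
apply/lfunP => f; apply/ffunP => A; rewrite add_lfunE opp_lfunE scale_lfunE !comp_lfunE !ffunE !contrE !wedgeE /ins !contrE /ins !wedgeE !inE.
have [<-|ij] := eqVneq i j.
  rewrite /= scale1r id_lfunE; case: (boolP (i \in A)) => iA /=.
    by rewrite setD1K // -/(sg F (A :\ i) i) sgD // ltI_irr expr0 mul1r mulrA sg_sqr mul1r subrr.
  rewrite subr0 setU1K // -/(sg F _ _) sgU // ltI_irr expr0 mul1r.
  by rewrite mulrA sg_sqr mul1r.
rewrite /= !scale0r add0r.
case: (boolP (i \in A)) => iA; case: (boolP (j \in A)) => jA //=;
  rewrite ?mulr0 ?oppr0 //.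
rewrite -/(sg F _ _) -/(sg F _ _) sgU // sgD // (ltI_neg ij).
have -> : (i |: A) :\ j = i |: A :\ j.
  by apply/setP => x; rewrite !inE; case: eqVneq => // ->; rewrite eq_sym (negbTE ij).
by case: ltI; rewrite ?expr1 ?expr0 !(mul1r, mulN1r, mulNr, mulrN) ?opprK !mulrA (mulrC (sg _ _ i)).
Qed.

(** Needed for 1 to differ from 0 in the endomorphism ring; the cochain supported at the empty set
    is the witness. *)
Fact cochains_dim_gt0 : (0 < dim V)%N.
Proof.
rewrite lt0n -dimvf dimv_eq0; apply/eqP => V0.
have := memvf (delta F (set0 : {set I})); rewrite V0 memv0 => /eqP/ffunP/(_ set0).
by rewrite !ffunE eqxx => /eqP; rewrite oner_eq0.
Qed.

(* [lfun_algType] carries the opposite product; here the product is composition. *)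
Definition endR : nzRingType := lfun_comp_nzRingType cochains_dim_gt0.

Definition endL : lalgType F := HB.pack 'End(V) endR
  (GRing.Lmodule_isLalgebra.Build F endR (fun k x y => comp_lfunZl k x y)).
Definition endA : algType F := HB.pack 'End(V) endL
  (GRing.Lalgebra_isAlgebra.Build F endL (fun k x y => comp_lfunZr k x y)).

Lemma mul_endE (x y : endA) f : (x * y : endA) f = x (y f).
Proof. exact: comp_lfunE. Qed.

Lemma wedge_wedgeA i j : (wedge i : endA) * wedge j = - ((wedge j : endA) * wedge i).
Proof. exact: wedge_wedge. Qed.

Lemma contr_contrA i j : (contr i : endA) * contr j = - ((contr j : endA) * contr i).
Proof. exact: contr_contr. Qed.

Lemma contr_wedgeA i j :
  (contr i : endA) * wedge j = (i == j)%:R - (wedge j : endA) * contr i.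
Proof. by rewrite -[_%:R]mulr1 mulr_natl -scaler_nat; exact: contr_wedge. Qed.

End Fock.

(** * The Chevalley--Eilenberg differential in terms of these operators *)

Section Differential.
Variables (F : numFieldType) (I : finType) (c : I -> I -> I -> F).
Notation V := (cochains F I).
Implicit Types (i j : I) (A : {set I}) (f : V).

Hypothesis c_anti : forall u v w, c u v w = - c v u w.

Definition bracket_ins f u v : V := \sum_w c u v w *: contr F w f.

Lemma CEd_fun_ins f A : CEd_fun c f A =
  \sum_(s in A) \sum_(t in A | ltI s t) sg F A s * sg F A t * bracket_ins f s t (A :\ s :\ t).
Proof.
rewrite ffunE; apply: eq_bigr => s _; apply: eq_bigr => t _; rewrite exprD.
congr (_ * _); rewrite /bracket_ins sum_ffunE; apply: eq_bigr => w _.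
by rewrite ffunE contrE.
Qed.

(** [CEd] is a [linfun], which agrees with [CEd_fun] once linearity is known. *)
Fact CEd_fun_linear : linear (CEd_fun c).
Proof.
move=> x f g; apply/ffunP => A; rewrite !ffunE scaler_sumr -big_split.
apply: eq_bigr => s _ /=; rewrite scaler_sumr -big_split.
apply: eq_bigr => t _ /=; rewrite scalerAr -mulrDr; congr (_ * _).
rewrite scaler_sumr -big_split; apply: eq_bigr => w _ /=.
rewrite scalerAr -mulrDr; congr (_ * _); rewrite /ins.
by case: ifP => _; rewrite ?scaler0 ?addr0 // !ffunE mulrDr scalerAr.
Qed.

HB.instance Definition _ := GRing.isLinear.Build F V V *:%R (CEd_fun c) CEd_fun_linear.

Lemma CEdE f : CEd c f = CEd_fun c f.
Proof. exact: lfunE. Qed.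

(** [Dop] sums over ordered pairs, so each increasing pair of [CEd] is met twice; removing the
    smaller index first shifts the position of the larger by one, whence the minus sign. *)
Lemma CEd_Dop : Dop (@wedge F I : I -> endA F I) (@contr F I) c = - (CEd c *+ 2) :> 'End(V).
Proof.
apply/lfunP => f; apply/ffunP => A.
transitivity ((\sum_u \sum_v wedge F u (wedge F v (bracket_ins f u v))) A).
  congr ((_ : V) A); rewrite /Dop sum_lfunE.
  under [LHS]eq_bigr => w _.
    rewrite mul_endE /qf sum_lfunE.
    under eq_bigr => u _ do rewrite sum_lfunE.
    over.
  rewrite exchange_big; apply: eq_bigr => u _ /=.
  rewrite exchange_big; apply: eq_bigr => v _ /=.
  rewrite /bracket_ins !linear_sum; apply: eq_bigr => w _ /=.
  by rewrite !linearZ scale_lfunE; rewrite mul_endE.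
(* [G] is the signed term of an ordered pair, antisymmetric in u and v; [K] keeps it only for
   increasing pairs. *)
pose G u v := if (u \in A) && (v \in A)
  then sg F A u * sg F A v * bracket_ins f u v (A :\ u :\ v) else 0.
have G_anti u v : G v u = - G u v.
  rewrite /G andbC; case: ifP => _; last by rewrite oppr0.
  have -> : bracket_ins f v u = - bracket_ins f u v.
    by rewrite /bracket_ins -sumrN; apply: eq_bigr => w _; rewrite c_anti scaleNr.
  by rewrite ffunE mulrN (mulrC (sg F A v)) setDDl setUC -setDDl.
pose K u v := if ltI u v then G u v else 0.
have wedgeK u v : wedge F u (wedge F v (bracket_ins f u v)) A = - K v u - K u v.
  rewrite !wedgeE !inE /K G_anti /G.
  have [->|vu] := eqVneq v u; first by rewrite ltI_irr /= mulr0 if_same oppr0 addr0.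
  rewrite /= (ltI_neg vu).
  case: (boolP (u \in A)) => uA; last by case: ltI; rewrite /= ?oppr0 ?addr0.
  case: (boolP (v \in A)) => vA; last by rewrite mulr0; case: ltI; rewrite /= ?oppr0 ?addr0.
  rewrite sgD // (ltI_neg vu).
  by case: ltI; rewrite /= ?expr0 ?expr1 ?opprK ?oppr0 ?addr0 ?add0r ?(mul1r, mulN1r, mulrN, mulNr) mulrA.
rewrite sum_ffunE; under eq_bigr => u _.
  rewrite sum_ffunE; under eq_bigr => v _ do rewrite wedgeK.
  rewrite sumrB sumrN.
  over.
rewrite sumrB sumrN exchange_big -opprD opp_lfunE mulr2n add_lfunE CEdE !ffunE.
have -> : \sum_u \sum_v K u v = CEd_fun c f A.
  rewrite CEd_fun_ins [RHS]big_mkcond; apply: eq_bigr => u _.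
  rewrite /K /G; case: ifP => uA /=; last by rewrite big1 // => v _; case: ltI.
  by rewrite [RHS]big_mkcond; apply: eq_bigr => v _; case: (v \in A); case: ltI.
by rewrite ffunE.
Qed.

Hypothesis c_jacobi : forall u v x z,
  \sum_w (c u v w * c w x z + c v x w * c w u z + c x u w * c w v z) = 0.

(** The square of [Dop] is 4 times that of [CEd], and 4 is invertible. *)
Lemma CEd_sqr f : CEd c (CEd c f) = 0.
Proof.
have := Dop_sqr (@wedge_wedgeA F I) (@contr_contrA F I) (@contr_wedgeA F I) c_anti c_jacobi.
rewrite CEd_Dop => /lfunP/(_ f).
have D2 g : (- (CEd c *+ 2)) g = - (CEd c g *+ 2).
  by rewrite opp_lfunE mulr2n add_lfunE -mulr2n.
rewrite mul_endE !D2 linearN mulNrn opprK linearMn /= zero_lfunE => /eqP.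
rewrite -mulrnA -scaler_nat.
by rewrite scaler_eq0 pnatr_eq0 => /eqP.
Qed.

End Differential.

(** * Degrees of cochains *)

Section Degree.
Variables (F : fieldType) (I : finType).
Notation V := (cochains F I).
Implicit Types (i j : I) (A : {set I}) (f : V).

(** In the basis of all [delta A] the coordinate of f at A is f A, so lying in the span is a
    condition on the support. *)
Lemma CdegP k f : reflect (forall A, #|A| != k -> f A = 0) (f \in Cdeg F I k).
Proof.
rewrite /Cdeg; set X := [seq _ | _ <- _]; apply: (iffP idP) => [fX A Ak|f0].
  rewrite (coord_span fX) sum_ffunE big1 // => i _.
  have : (in_tuple X)`_i \in X by apply: mem_nth; rewrite size_map -cardE ltn_ord.
  case/mapP => B; rewrite mem_enum inE => Bk ->; rewrite !ffunE.
  have [AB|] := eqVneq A B; last by rewrite scaler0.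
  by rewrite AB Bk in Ak.
have -> : f = \sum_B f B *: delta F B.
  apply/ffunP => A; rewrite sum_ffunE (bigD1 A) //= big1 => [|B BA].
    by rewrite !ffunE eqxx addr0 -[LHS]mulr1.
  by rewrite !ffunE eq_sym (negbTE BA) scaler0.
apply: memv_suml => B _; have [Bk|Bk] := boolP (#|B| == k).
  by apply/memvZ/memv_span/map_f; rewrite mem_enum inE.
by rewrite f0 // scale0r mem0v.
Qed.

Lemma wedge_deg k i f : f \in Cdeg F I k -> wedge F i f \in Cdeg F I k.+1.
Proof.
move/CdegP => f0; apply/CdegP => A Ak; rewrite wedgeE; case: ifP => // iA.
by rewrite f0 ?mulr0 //; move: Ak; rewrite (cardsD1 i) iA.
Qed.

Lemma contr_deg k i f : f \in Cdeg F I k.+1 -> contr F i f \in Cdeg F I k.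
Proof.
move/CdegP => f0; apply/CdegP => A Ak; rewrite contrE /ins; case: ifPn => // iA.
by rewrite f0 ?mulr0 // cardsU1 iA.
Qed.

Lemma contr_deg0 i f : f \in Cdeg F I 0 -> contr F i f = 0.
Proof.
move/CdegP => f0; apply/ffunP => A; rewrite contrE /ins ffunE; case: ifPn => // iA.
by rewrite f0 ?mulr0 // cardsU1 iA.
Qed.

Lemma wedge_contr_deg k i j f : f \in Cdeg F I k -> wedge F i (contr F j f) \in Cdeg F I k.
Proof.
case: k => [|k] fk; first by rewrite contr_deg0 // linear0 mem0v.
exact/wedge_deg/contr_deg.
Qed.

End Degree.

Lemma CEd_deg (F : numFieldType) (I : finType) (c : I -> I -> I -> F) k f :
  f \in Cdeg F I k -> CEd c f \in Cdeg F I k.+1.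
Proof.
move/CdegP => f0; apply/CdegP => A Ak; rewrite CEdE ffunE.
rewrite big1 // => s sA; rewrite big1 // => t /andP[tA st].
rewrite big1 ?mulr0 // => m _; rewrite /ins; case: ifPn => [_|mA]; first by rewrite mulr0.
have ts : t != s by apply: contraTneq st => ->; rewrite ltI_irr.
rewrite f0 ?mulr0 // cardsU1 mA.
by move: Ak; rewrite (cardsD1 s) sA (cardsD1 t) !inE ts tA.
Qed.

(** * Subsets of a disjoint sum and their order *)

Section SumSets.
Variables S T : finType.
Implicit Types (A : {set S + T}) (B : {set S}) (U : {set T}) (s : S) (t : T).

Definition join B U : {set S + T} :=
  [set x | match x with inl s => s \in B | inr t => t \in U end].
Definition lpart A : {set S} := [set s | inl s \in A].
Definition rpart A : {set T} := [set t | inr t \in A].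

Lemma join_parts A : join (lpart A) (rpart A) = A.
Proof. by apply/setP => -[x|x]; rewrite !inE. Qed.

Lemma lpart_join B U : lpart (join B U) = B.
Proof. by apply/setP => x; rewrite !inE. Qed.

Lemma rpart_join B U : rpart (join B U) = U.
Proof. by apply/setP => x; rewrite !inE. Qed.

Lemma card_join B U : #|join B U| = (#|B| + #|U|)%N.
Proof.
have -> : join B U = [set inl s | s in B] :|: [set inr t | t in U].
  apply/setP => -[x|x]; rewrite !inE.
    rewrite mem_imset; last by move=> ? ? [].
    by rewrite orbC; case: imsetP => // -[].
  rewrite mem_imset; last by move=> ? ? [].
  by case: imsetP => // -[].
rewrite cardsU !card_imset; try by move=> ? ? [].
rewrite [X in (_ - X)%N]eq_card0 ?subn0 // => x; rewrite !inE.
by apply/negP => /andP[/imsetP[? _ ->]] /imsetP[].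
Qed.

Lemma joinD1 B U s : join B U :\ inl s = join (B :\ s) U.
Proof. by apply/setP => -[x|x]; rewrite !inE. Qed.

Lemma joinU1 B U s : inl s |: join B U = join (s |: B) U.
Proof. by apply/setP => -[x|x]; rewrite !inE. Qed.

Lemma enum_rank_index (J : finType) (x : J) : val (enum_rank x) = index x (enum J).
Proof.
by rewrite -{2}(nth_enum_rank x x) index_uniq ?enum_uniq // -cardE ltn_ord.
Qed.

(** Every index from [S] thus precedes every index from [T], so the [T] part of a set does not
    affect positions of indices from [S]. *)
Lemma enum_sumE : enum {: S + T} = [seq inl s | s <- enum S] ++ [seq inr t | t <- enum T].
Proof. by rewrite !enumT [in LHS]unlock. Qed.

Lemma rank_inl s : val (enum_rank (inl s : S + T)) = val (enum_rank s).
Proof.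
rewrite !enum_rank_index enum_sumE index_cat map_f ?mem_enum //.
by rewrite index_map // => ? ? [].
Qed.

Lemma rank_inr t : val (enum_rank (inr t : S + T)) = (#|S| + val (enum_rank t))%N.
Proof.
rewrite !enum_rank_index enum_sumE index_cat size_map -cardE.
have /negPf -> : inr t \notin [seq (inl s : S + T) | s <- enum S].
  by apply/mapP => -[].
by rewrite index_map // => ? ? [].
Qed.

Lemma ltI_ll s1 s2 : ltI (inl s1 : S + T) (inl s2) = ltI s1 s2.
Proof. by rewrite /ltI !rank_inl. Qed.

Lemma ltI_rl t s : ltI (inr t : S + T) (inl s) = false.
Proof.
rewrite /ltI rank_inl rank_inr; apply/negbTE.
by rewrite -leqNgt ltnW // ltn_addr //; exact: ltn_ord.
Qed.

Lemma pos_join B U s : Defs.pos (join B U) (inl s) = Defs.pos B s.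
Proof.
rewrite /Defs.pos; have -> : [set y in join B U | ltI y (inl s)] = join [set y in B | ltI y s] set0.
  by apply/setP => -[x|x]; rewrite !inE ?ltI_ll ?ltI_rl ?andbF.
by rewrite card_join cards0 addn0.
Qed.

End SumSets.

(** * The components of a cochain in the lowest and highest exterior powers of the ideal *)

Section Restriction.
Variables (F : numFieldType) (S T : finType) (c : S + T -> S + T -> S + T -> F).
Notation I := (S + T)%type.
Hypothesis c_SST : forall s t k, c (inl s) (inl t) (inr k) = 0.
Hypothesis c_STS : forall s i r, c (inl s) (inr i) (inl r) = 0.
Hypothesis c_TT : forall i j w, c (inr i) (inr j) w = 0.
Implicit Type U : {set T}.
Hypothesis c_diag : forall s i, c (inl s) (inr i) (inr i) = 0.

Definition sub_c (u v w : S) : F := c (inl u) (inl v) (inl w).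

(** The coefficient of the monomial dx^U. As [S] comes before [T], no sign occurs: a cochain is the
    sum over U of its coefficient wedge dx^U, and [ext U g] below is g wedge dx^U. *)
Definition res_fun (U : {set T}) (f : cochains F I) : cochains F S :=
  [ffun B : {set S} => f (join B U)].

Fact res_fun_linear U : linear (res_fun U).
Proof. by move=> x f g; apply/ffunP => B; rewrite !ffunE. Qed.
HB.instance Definition _ U :=
  GRing.isLinear.Build F (cochains F I) (cochains F S) *:%R (res_fun U) (res_fun_linear U).

Definition res U : 'Hom(cochains F I, cochains F S) := linfun (res_fun U).

Definition ext (U : {set T}) (g : cochains F S) : cochains F I :=
  [ffun A : {set I} => if rpart A == U then g (lpart A) else 0].

Lemma resE U f B : res U f B = f (join B U).
Proof. by rewrite lfunE ffunE. Qed.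

Lemma res_ext U g : res U (ext U g) = g.
Proof. by apply/ffunP => B; rewrite resE ffunE rpart_join eqxx lpart_join. Qed.

Lemma res_ext_neq U U' g : U != U' -> res U (ext U' g) = 0.
Proof.
by move=> UU; apply/ffunP => B; rewrite resE !ffunE rpart_join (negbTE UU).
Qed.

(* Index sets of the monomials in the dx^i spanning Lambda^0 and Lambda^n, on
   which so(p,q) acts trivially. *)
Definition trivial_set (U : {set T}) := (U == set0) || (U == setT).

(** Pairs from [S] give the differential of the subalgebra and pairs from [T] commute. Mixed pairs
    contribute nothing because the action on dx^U is trivial. *)
Lemma res_CEd U f : trivial_set U -> res U (CEd c f) = CEd sub_c (res U f).
Proof.
move=> tU; apply/ffunP => B; rewrite resE !CEdE !ffunE big_sumType /=.
rewrite [X in _ + X]big1 ?addr0 => [|i _]; last first.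
  rewrite big1 // => -[t|j]; first by rewrite ltI_rl andbF.
  by move=> _; rewrite big1 ?mulr0 // => m _; rewrite c_TT mul0r.
apply: eq_big => s; first by rewrite inE.
move=> _; rewrite big_sumType /= [X in _ + X]big1 ?addr0 => [|j]; last first.
  rewrite inE => /andP[jU _]; rewrite big1 ?mulr0 // => -[r|k] _.
    by rewrite c_STS mul0r.
  have [->|kj] := eqVneq k j; first by rewrite c_diag mul0r.
  (* Here j belongs to U, so U is full. Then k, being different from j, is still present after j is
     removed, and inserting it again gives 0. *)
  rewrite /ins !inE; case: ifPn; rewrite ?mulr0 // => kU.
  case/orP: tU kU jU kj => /eqP -> /=; rewrite !inE //.
  by move=> /[swap] _ /[swap] /negPf; rewrite (inj_eq (@inr_inj S T)) => ->.
apply: eq_big => t; first by rewrite inE ltI_ll.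
move=> _; rewrite !pos_join; congr (_ * _).
rewrite big_sumType /= [X in _ + X]big1 ?addr0 => [|k _]; last by rewrite c_SST mul0r.
apply: eq_bigr => m _; congr (_ * _).
by rewrite /ins !joinD1 inE pos_join joinU1 resE.
Qed.

Lemma ext_CEd U g : trivial_set U -> CEd c (ext U g) = ext U (CEd sub_c g).
Proof.
move=> tU; apply/ffunP => A; rewrite [RHS]ffunE; case: ifPn => [/eqP AU|AU].
  rewrite -{1}(join_parts A) AU -resE res_CEd // res_ext.
  by [].
rewrite CEdE ffunE big1 // => s sA; rewrite big1 // => t /andP[tA].
case: s sA => [s|i] sA; last first.
  case: t tA => [t|j] tA; first by rewrite ltI_rl.
  by move=> _; rewrite big1 ?mulr0 // => m _; rewrite c_TT mul0r.
move=> _; rewrite big1 ?mulr0 // => -[r|k] _.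
  case: t tA => [t|j] tA; last by rewrite c_STS mul0r.
  rewrite /ins; case: ifP => _; rewrite ?mulr0 // ffunE.
  have -> : rpart (inl r |: A :\ inl s :\ inl t) = rpart A by apply/setP => x; rewrite !inE.
  by rewrite (negbTE AU) !mulr0.
case: t tA => [t|j] tA; first by rewrite c_SST mul0r.
rewrite /ins; case: ifP => _; rewrite ?mulr0 // ffunE.
case: ifP => [/eqP E|_]; last by rewrite !mulr0.
(* A mixed pair trades j for k in the [T] part. If the result is U, then U contains k and is
   therefore full; so j = k, and the [T] part of A was already U. *)
have kU : k \in U by rewrite -E !inE eqxx.
have UT : U = setT by case/orP: tU kU => /eqP -> //; rewrite inE.
have : j \in U by rewrite UT inE.
rewrite -E !inE /= !(inj_eq (@inr_inj S T)) eqxx /= orbF => /eqP jk.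
case/eqP: AU; rewrite -E; apply/setP => x; rewrite !inE /= !(inj_eq (@inr_inj S T)) jk.
by case: eqVneq => [->|//]; rewrite -jk tA.
Qed.

Lemma res_deg U k f :
  f \in Cdeg F I (k + #|U|) -> res U f \in Cdeg F S k.
Proof.
move/CdegP => f0; apply/CdegP => B Bk.
by rewrite resE f0 // card_join eqn_add2r.
Qed.

Lemma res_small U k f : (k < #|U|)%N -> f \in Cdeg F I k -> res U f = 0.
Proof.
move=> kU /CdegP f0; apply/ffunP => B; rewrite resE f0 ?ffunE // card_join.
by rewrite neq_ltn (leq_trans kU) ?leq_addl ?orbT.
Qed.

Lemma ext_deg U k g : g \in Cdeg F S k -> ext U g \in Cdeg F I (k + #|U|).
Proof.
move/CdegP => g0; apply/CdegP => A; rewrite -{1}(join_parts A) card_join ffunE.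
by case: ifP => // /eqP ->; rewrite eqn_add2r => /g0.
Qed.

End Restriction.

(** * Cohomology of a semidirect product whose Casimir operator is diagonal *)

Lemma cocyclesP (F : fieldType) (J : finType) (c : J -> J -> J -> F) k f :
  reflect (f \in Cdeg F J k /\ CEd c f = 0) (f \in cocycles c k).
Proof. by rewrite memv_cap memv_ker; apply: (iffP andP) => -[? /eqP]. Qed.

Section Semidirect.
Variables (F : numFieldType) (S T : finType) (c : S + T -> S + T -> S + T -> F).
Variables (kappa : S -> F) (lam : {set S + T} -> F).
Notation I := (S + T)%type.
Notation endI := (endA F I).
Implicit Types (U : {set T}) (A : {set S + T}) (f : cochains F I) (g : cochains F S).
Hypothesis c_anti : forall u v w, c u v w = - c v u w.
Hypothesis c_jacobi : forall u v x z,
  \sum_w (c u v w * c w x z + c v x w * c w u z + c x u w * c w v z) = 0.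
Hypothesis c_SST : forall s t k, c (inl s) (inl t) (inr k) = 0.
Hypothesis c_STS : forall s i r, c (inl s) (inr i) (inl r) = 0.
Hypothesis c_TT : forall i j w, c (inr i) (inr j) w = 0.
Hypothesis c_diag : forall s i, c (inl s) (inr i) (inr i) = 0.
Hypothesis kappa_inv : forall s b r,
  kappa s * c (inl s) (inl b) (inl r) + kappa r * c (inl r) (inl b) (inl s) = 0.

Definition actX (s : S) : endI := Xop (@wedge F I : I -> endI) (@contr F I) c s.

(** The Casimir operator is diagonal on monomials, and its eigenvalue vanishes only on the lowest
    and highest exterior powers of the ideal. *)
Hypothesis casimir_diag : forall f A,
  (\sum_s kappa s *: actX s (actX s f)) A = - (lam A * f A).
Hypothesis lam_eq0 : forall A, lam A = 0 -> trivial_set (rpart A).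
Hypothesis T_gt0 : (0 < #|T|)%N.

Definition homotopy : 'End(cochains F I) :=
  Hop (@wedge F I : I -> endI) (@contr F I) c kappa.

Lemma homotopyP f A :
  (CEd c (homotopy f) + homotopy (CEd c f)) A = lam A * f A.
Proof.
have /lfunP/(_ f) := Dop_Hop (@wedge_wedgeA F I) (@contr_contrA F I) (@contr_wedgeA F I)
  c_anti c_jacobi c_SST c_STS c_TT kappa_inv.
rewrite CEd_Dop // -/homotopy.
have M2 (x : 'End(cochains F I)) f' : (x *+ 2) f' = x f' *+ 2.
  by rewrite mulr2n add_lfunE -mulr2n.
have H2 f' : homotopy (- (f' *+ 2)) = - (homotopy f' *+ 2).
  by rewrite linearN; congr (- _); exact: linearMn.
have XX : (\sum_s kappa s *: (actX s * actX s) : endI) f =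
    \sum_s kappa s *: actX s (actX s f).
  by rewrite sum_lfunE; apply: eq_bigr => s _; rewrite scale_lfunE mul_endE.
rewrite [LHS]add_lfunE !mul_endE !opp_lfunE !M2 H2 -opprD -mulrnDl -mulNrn XX.
have two0 : (2%:R : F) != 0 by rewrite pnatr_eq0.
rewrite -!scaler_nat => /(scalerI two0) E.
by apply: oppr_inj; rewrite -casimir_diag -E [RHS]ffunE.
Qed.

Lemma homotopy_deg k f : f \in Cdeg F I k.+1 -> homotopy f \in Cdeg F I k.
Proof.
move=> fk; rewrite /homotopy /Hop sum_lfunE; apply: memv_suml => s _.
rewrite scale_lfunE memvZ // mul_endE; set g := contr _ _ _.
have {fk}: g \in Cdeg F I k by exact: contr_deg.
move: g => g gk; rewrite /Xop sum_lfunE; apply: memv_suml => i _.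
rewrite sum_lfunE; apply: memv_suml => j _.
by rewrite scale_lfunE memvZ // mul_endE wedge_contr_deg.
Qed.

Let cS := sub_c c.
Let Z k := cocycles c k.
Let B k := coboundaries c k.
Let d := #|T|.
Let r0 := res F S (set0 : {set T}).
Let r1 := res F S (setT : {set T}).

Lemma coboundaries_cocycles k : (B k <= Z k)%VS.
Proof.
apply/subvP => f; case: k => [|k] /=.
  by rewrite memv0 => /eqP ->; rewrite mem0v.
case/memv_imgP => g gk ->; apply/cocyclesP.
by rewrite CEd_deg // CEd_sqr.
Qed.

Lemma set0_neqT : (set0 : {set T}) != setT.
Proof. by apply/eqP => E; move: T_gt0; rewrite -cardsT -E cards0. Qed.

Lemma res_eq0 U f A : res F S U f = 0 -> rpart A = U -> f A = 0.
Proof.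
by move=> /ffunP/(_ (lpart A)) + AU; rewrite resE ffunE -AU join_parts.
Qed.

(** When both extreme components vanish, the Casimir operator can be inverted. Writing a cocycle f
    as its value on g, one shows that g is closed, and the homotopy formula gives f = d(Hg). *)
Lemma mid_exact k : (Z k :&: lker r0 :&: lker r1 = B k :&: lker r0 :&: lker r1)%VS.
Proof.
apply/eqP; rewrite eqEsubv; apply/andP; split; last by rewrite !capvS ?coboundaries_cocycles.
apply/subvP => f; rewrite 2!memv_cap => /andP[/andP[/cocyclesP[fk df0] f0] f1].
rewrite 2!memv_cap f0 f1 !andbT; move: f0 f1; rewrite !memv_ker => /eqP f0 /eqP f1.
have f_triv U : trivial_set U -> res F S U f = 0 by case/orP => /eqP ->.
(* [g] is a preimage of [f] under the Casimir operator. *)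
pose g : cochains F I := [ffun A : {set I} => (lam A)^-1 * f A].
have lamg A : lam A * g A = f A.
  (* Where [lam] vanishes its inverse is 0 by convention, which is harmless since f vanishes there
     as well. *)
  rewrite ffunE; have [l0|l0] := eqVneq (lam A) 0; last by rewrite mulVKf.
  by rewrite l0 mul0r (res_eq0 (f_triv _ (lam_eq0 l0)) erefl).
have g_triv U : trivial_set U -> res F S U g = 0.
  move=> /f_triv/ffunP fU; apply/ffunP => B'; move: (fU B'); rewrite !resE !ffunE => ->.
  by rewrite mulr0.
have fE : f = CEd c (homotopy g) + homotopy (CEd c g).
  by apply/ffunP => A; rewrite homotopyP lamg.
(* Since d^2 = 0, the homotopy formula at dg reads lam dg = d H d g = df = 0. This settles the
   nonzero eigenvalues; elsewhere dg is a differential of a zero restriction. *)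
have dg0 : CEd c g = 0.
  apply/ffunP => A; rewrite [RHS]ffunE; have [l0|l0] := eqVneq (lam A) 0.
    apply: (@res_eq0 (rpart A)) => //.
    by rewrite res_CEd ?g_triv ?linear0 // lam_eq0.
  apply: (mulfI l0); rewrite mulr0 -homotopyP CEd_sqr // linear0 addr0.
  have := df0; rewrite {1}fE linearD /= CEd_sqr // add0r => ->.
  by rewrite ffunE.
have gk : g \in Cdeg F I k.
  by apply/CdegP => A Ak; rewrite ffunE (CdegP _ _ fk) // mulr0.
move: fE; rewrite dg0 linear0 addr0 /B => fE.
case: k fk gk => [|k] fk gk /=; last by rewrite fE memv_img // homotopy_deg.
(* In degree 0 the only coboundary is 0, and f is supported at the empty set, where its restriction
   [r0] already vanishes. *)
suff -> : f = 0 by rewrite mem0v.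
apply/ffunP => A; rewrite [RHS]ffunE.
have [A0|A0] := eqVneq A set0; last by apply: (CdegP _ _ fk); rewrite cards_eq0.
apply: (res_eq0 f0); rewrite A0; apply/setP => t; rewrite !inE.
by [].
Qed.

Lemma res_cocycles U k f : trivial_set U ->
  f \in Z (k + #|U|)%N -> res F S U f \in cocycles cS k.
Proof.
move=> tU /cocyclesP[fk df0]; apply/cocyclesP; split; first exact: res_deg.
by rewrite -res_CEd // df0 linear0.
Qed.

Lemma ext_cocycles U k g : trivial_set U ->
  g \in cocycles cS k -> ext U g \in Z (k + #|U|)%N.
Proof.
move=> tU /cocyclesP[gk dg0]; apply/cocyclesP; split; first exact: ext_deg.
rewrite ext_CEd // dg0; apply/ffunP => A; rewrite !ffunE.
by rewrite if_same.
Qed.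

Lemma res_coboundaries U k f : trivial_set U ->
  f \in B (k + #|U|)%N -> res F S U f \in coboundaries cS k.
Proof.
case: k => [|k] tU fB.
  have fk : f \in Cdeg F I (0 + #|U|)%N.
    by have /subvP/(_ _ fB)/cocyclesP[] := coboundaries_cocycles (0 + #|U|)%N.
  case/orP: tU fB fk => /eqP ->.
    by rewrite cards0 /B /= memv0 => /eqP -> _; rewrite linear0 mem0v.
  (* A coboundary of degree n = |T| comes from degree n - 1, where no cochain contains the full
     monomial of the ideal. *)
  rewrite cardsT add0n -/d /B; move: T_gt0; rewrite -/d; case Ed: d => [//|d'] _ /=.
  case/memv_imgP => g gk -> _; rewrite res_CEd ?(@res_small _ _ _ setT d') ?linear0 ?mem0v //.
    by rewrite cardsT -/d Ed.
  by rewrite /trivial_set eqxx orbT.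
case/memv_imgP: fB => g gk ->; rewrite res_CEd //.
by rewrite memv_img // res_deg.
Qed.

Lemma ext_coboundaries U k g : trivial_set U ->
  g \in coboundaries cS k -> ext U g \in B (k + #|U|)%N.
Proof.
move=> tU; case: k => [|k] /=.
  rewrite memv0 => /eqP ->; suff -> : ext U (0 : cochains F S) = 0 by rewrite mem0v.
  by apply/ffunP => A; rewrite !ffunE if_same.
case/memv_imgP => h hk ->; rewrite -ext_CEd //.
by apply: memv_img; rewrite ext_deg.
Qed.

Let tr0 : trivial_set (set0 : {set T}).
Proof. by rewrite /trivial_set eqxx. Qed.
Let tr1 : trivial_set (setT : {set T}).
Proof. by rewrite /trivial_set eqxx orbT. Qed.

(** Stated for arbitrary families so as to serve both cocycles and coboundaries; surjectivity holds
    because [ext] is a section of [res]. *)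
Lemma img_r0 (P Q : nat -> {vspace _}) k :
    (forall U k f, trivial_set U -> f \in P (k + #|U|)%N -> res F S U f \in Q k) ->
    (forall U k g, trivial_set U -> g \in Q k -> ext U g \in P (k + #|U|)%N) ->
  (r0 @: P k = Q k)%VS.
Proof.
move=> resP extP; apply/vspaceP => g; apply/idP/idP.
  by case/memv_imgP => f fP ->; apply: (resP set0 k f tr0); rewrite cards0 addn0.
move=> gQ; rewrite -(res_ext (set0 : {set T}) g) memv_img //.
by rewrite -[k]addn0 -(cards0 T) extP.
Qed.

(** The section by the full monomial takes values in the kernel of [r0], since the empty and the
    full set differ. *)
Lemma img_r1 (P Q : nat -> {vspace _}) k :
    (forall U k f, trivial_set U -> f \in P (k + #|U|)%N -> res F S U f \in Q k) ->
    (forall U k g, trivial_set U -> g \in Q k -> ext U g \in P (k + #|U|)%N) ->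
  (r1 @: (P (k + d)%N :&: lker r0) = Q k)%VS.
Proof.
move=> resP extP; apply/vspaceP => g; apply/idP/idP.
  case/memv_imgP => f; rewrite memv_cap => /andP[fP _] ->.
  by apply: (resP setT k f tr1); rewrite cardsT.
move=> gQ; rewrite -(res_ext (setT : {set T}) g) memv_img // memv_cap /d -cardsT extP //.
by rewrite memv_ker res_ext_neq ?set0_neqT ?eqxx.
Qed.

Lemma img_r1_small (W : {vspace _}) k : (k < d)%N -> (W <= Cdeg F I k)%VS ->
  (r1 @: (W :&: lker r0) = 0)%VS.
Proof.
move=> kd /subvP Wk; apply/eqP; rewrite -subv0; apply/subvP => g.
case/memv_imgP => f; rewrite memv_cap => /andP[/Wk fk _] ->.
by rewrite /r1 (@res_small _ _ _ _ k) ?mem0v // cardsT.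
Qed.

(** Rank-nullity for [r0], then for [r1] on its kernel, splits each dimension in three. The doubly
    restricted kernels agree for cocycles and coboundaries; the images are those of the subalgebra
    in degrees k and k - |T|. *)
Theorem Hdim_semidirect k :
  Hdim c k = (Hdim cS k + (if (#|T| <= k)%N then Hdim cS (k - #|T|) else 0))%N.
Proof.
have split_dim (W : {vspace cochains F I}) : \dim W =
    (\dim (W :&: lker r0 :&: lker r1) + \dim (r1 @: (W :&: lker r0)) + \dim (r0 @: W))%N.
  by rewrite limg_ker_dim limg_ker_dim.
have imZ := img_r0 k res_cocycles ext_cocycles.
have imB := img_r0 k res_coboundaries ext_coboundaries.
have leS j : (\dim (coboundaries cS j) <= \dim (cocycles cS j))%N.
  rewrite -(img_r0 j res_cocycles ext_cocycles) -(img_r0 j res_coboundaries ext_coboundaries).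
  by rewrite dimvS // limgS // coboundaries_cocycles.
(* Subtraction of natural numbers is truncated, so the two differences separate only given these
   inequalities. *)
have arith m z0 z1 b0 b1 : (b0 <= z0 -> b1 <= z1 ->
    m + z1 + z0 - (m + b1 + b0) = z0 - b0 + (z1 - b1))%N by lia.
rewrite /Hdim -/(Z k) -/(B k) (split_dim (Z k)) (split_dim (B k)) mid_exact imZ imB.
case: leqP => dk.
  have imZ1 := img_r1 (k - d)%N res_cocycles ext_cocycles.
  have imB1 := img_r1 (k - d)%N res_coboundaries ext_coboundaries.
  rewrite subnK // in imZ1 imB1; rewrite imZ1 imB1 -/d.
  by apply: arith; apply: leS.
have Zk : (Z k <= Cdeg F I k)%VS by exact: capvSl.
rewrite !(img_r1_small dk) //; first by rewrite dimv0 !addn0 subnDl.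
exact: subv_trans (coboundaries_cocycles k) Zk.
Qed.

End Semidirect.

(** * Matrices of so(p,q) and the trace form *)

Lemma mxDE (V : nmodType) (m n : nat) (A B : 'M[V]_(m, n)) i j :
  (A + B) i j = A i j + B i j.
Proof. by rewrite mxE. Qed.

Lemma mxNE (V : zmodType) (m n : nat) (A : 'M[V]_(m, n)) i j : (- A) i j = - A i j.
Proof. by rewrite mxE. Qed.

Lemma mxBE (V : zmodType) (m n : nat) (A B : 'M[V]_(m, n)) i j :
  (A - B) i j = A i j - B i j.
Proof. by rewrite mxDE mxNE. Qed.

Lemma mxZE (A : pzRingType) (m n : nat) (a : A) (B : 'M[A]_(m, n)) i j :
  (a *: B) i j = a * B i j.
Proof. by rewrite mxE. Qed.

Section AffineAlgebra.
Variables p n : nat.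
Notation M := 'M[R]_n.
Implicit Types (i j k : 'I_n) (s : pairI n).

Definition eta i : R := (if (i < p)%N then 1 else -1)%R.

(** The weight kappa_s: 1 on the alpha_ij and -1 on the beta_ij. *)
Definition pair_sign s : R := (eta (val s).1 * eta (val s).2)%R.

Lemma eta_sqr i : eta i * eta i = 1.
Proof. by rewrite /eta; case: ifP => _; rewrite ?mulrNN mulr1. Qed.

Lemma pair_sign_sqr s : pair_sign s * pair_sign s = 1.
Proof. by rewrite /pair_sign mulrACA !eta_sqr mulr1. Qed.

Lemma pair_neq s : (val s).1 != (val s).2.
Proof. by case: s => -[i j] /= ij; rewrite -val_eqE neq_ltn ij. Qed.

Lemma soBasisE s : soBasis p s =
  delta_mx (val s).2 (val s).1 - pair_sign s *: delta_mx (val s).1 (val s).2.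
Proof.
apply/matrixP => k l; rewrite !mxE; have := pair_neq s; rewrite /pair_sign.
case: (val s) => i j /= ij.
have -> : (if sameblock p i j then -1 else 1) = - (eta i * eta j).
  by rewrite /sameblock /eta; do 2!case: (_ < p)%N; rewrite /= ?mulrNN ?mulr1 ?mul1r ?opprK.
have [kj|kj] /= := eqVneq k j.
  rewrite kj [j == i]eq_sym (negbTE ij) /= mulr0 subr0.
  by case: eqP.
by case: ifP => _; rewrite ?mulr1 ?mulr0 ?oppr0 add0r.
Qed.

(** The entrywise form of A^T eta + eta A = 0, for the diagonal metric with entries [eta i]. *)
Definition is_so (A : M) := forall i j, A i j = - (eta i * eta j * A j i).

Lemma is_so0 : is_so 0.
Proof. by move=> i j; rewrite !mxE mulr0 oppr0. Qed.

Lemma is_so_basis s : is_so (soBasis p s).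
Proof.
move=> i j; rewrite soBasisE !mxE (andbC (j == _)) (andbC (j == (val s).1)).
have := pair_sign_sqr s; rewrite /pair_sign.
set e := eta (val s).1 * eta (val s).2 => ss.
case: (boolP ((i == (val s).2) && _)) => [/andP[/eqP -> /eqP ->]|_].
  by rewrite (mulrC (eta _)) -/e mulrBr mulrA ss; ring.
case: (boolP (_ && _)) => [/andP[/eqP -> /eqP ->]|_].
  by rewrite -/e mulrBr mulrA ss; ring.
by rewrite !mulr0 !subr0 mulr0 oppr0.
Qed.

Lemma is_so_comm A B : is_so A -> is_so B -> is_so (A *m B - B *m A).
Proof.
have prodE C D : is_so C -> is_so D ->
    forall i j, (C *m D) i j = eta i * eta j * (D *m C) j i.
  move=> hC hD i j; rewrite !mxE mulr_sumr; apply: eq_bigr => k _.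
  rewrite hC hD mulrNN; have := eta_sqr k; set ek := eta k => kk.
  by rewrite -[RHS]mul1r -kk; ring.
move=> hA hB i j; rewrite !mxBE (prodE _ _ hA hB) (prodE _ _ hB hA i j).
by ring.
Qed.

(** Such a matrix is determined by its entries below the diagonal, where each basis matrix has a
    single entry, equal to 1. *)
Lemma so_expand A : is_so A ->
  A = \sum_s A (val s).2 (val s).1 *: soBasis p s.
Proof.
move=> hA; apply/matrixP => i j; rewrite summxE.
under eq_bigr => s _ do rewrite soBasisE !mxE.
have [ij|ji|/val_inj ij] := ltngtP i j.
- rewrite (bigD1 (Sub (i, j) ij)) //= big1 => [|s sij].
    rewrite /pair_sign /= (gtn_eqF ij : (j == i) = false) andbF.
    by rewrite !eqxx hA /=; ring.
  have /negPf -> : ~~ ((i == (val s).2) && (j == (val s).1)).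
    apply/negP => /andP[/eqP E1 /eqP E2]; have := valP s.
    by rewrite -E1 -E2 ltnNge ltnW.
  have /negPf -> : ~~ ((i == (val s).1) && (j == (val s).2)).
    apply: contraNN sij => /andP[/eqP E1 /eqP E2].
    by rewrite -val_eqE SubK E1 E2 -surjective_pairing.
  by rewrite mulr0 subr0 mulr0.
- rewrite (bigD1 (Sub (j, i) ji)) //= big1 => [|s sij].
    rewrite /pair_sign /= !eqxx (gtn_eqF ji : (i == j) = false) /=.
    by ring.
  have /negPf -> : ~~ ((i == (val s).1) && (j == (val s).2)).
    apply/negP => /andP[/eqP E1 /eqP E2]; have := valP s.
    by rewrite -E1 -E2 ltnNge ltnW.
  have /negPf -> : ~~ ((i == (val s).2) && (j == (val s).1)).
    apply: contraNN sij => /andP[/eqP E1 /eqP E2].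
    by rewrite -val_eqE SubK E1 E2 -surjective_pairing.
  by rewrite mulr0 subr0 mulr0.
rewrite ij big1 => [|s _].
  by have := hA j j; rewrite eta_sqr mul1r; lra.
have := pair_neq s; rewrite eq_sym => /negPf xy.
have [->|] := eqVneq j (val s).2; first by rewrite xy mulr0 subr0 mulr0.
by rewrite andbF mulr0 subr0 mulr0.
Qed.

(** The trace form against a basis matrix reads off one coordinate, so the basis is orthogonal. *)
Lemma trace_basis A s : is_so A ->
  \tr (A *m soBasis p s) = - (pair_sign s * A (val s).2 (val s).1) *+ 2.
Proof.
move=> hA; have tr_delta i j : \tr (A *m delta_mx i j) = A j i.
  rewrite /mxtrace (bigD1 j) //= big1 => [|k kj].
    rewrite mxE (bigD1 i) //= big1 => [|l li]; first by rewrite !mxE !eqxx mulr1 !addr0.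
    by rewrite !mxE (negbTE li) mulr0.
  by rewrite mxE big1 // => l _; rewrite !mxE (negbTE kj) andbF mulr0.
rewrite soBasisE mulmxBr -scalemxAr raddfB /= mxtraceZ !tr_delta hA -/(pair_sign s).
by ring.
Qed.

End AffineAlgebra.

(** * The bracket of affine vector fields *)

Section Bracket.
Variable n : nat.
Implicit Types U V W X : afield n.

Lemma afbr_anti V W : afbr V W = - afbr W V.
Proof. by congr pair; rewrite /= opprB. Qed.

Lemma afbr_jacobi U V X :
  afbr (afbr U V) X + afbr (afbr V X) U + afbr (afbr X U) V = 0.
Proof.
congr pair; apply/matrixP => i j; rewrite /= !(mulmxBr, mulmxBl, mulmxA, mxDE, mxNE) [RHS]mxE.
  by ring.
by ring.
Qed.

Lemma hCoordD w V W : hCoord w (V + W) = hCoord w V + hCoord w W.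
Proof. by case: w => x; rewrite /= mxE. Qed.

Lemma hCoordN w V : hCoord w (- V) = - hCoord w V.
Proof. by case: w => x; rewrite /= mxE. Qed.

(** Linearity of the bracket in V; it translates nested brackets into sums of products of structure
    constants. *)
Lemma afbr_expand p V X z : is_so p V.2 ->
  hCoord z (afbr V X) = \sum_w hCoord w V * hCoord z (afbr (hBasis p w) X).
Proof.
move=> hV; rewrite big_sumType /=.
have V1 : V.1 = \sum_i V.1 i 0 *: (\col_(k < n) (if k == i then 1 else 0)).
  apply/colP => k; rewrite summxE (bigD1 k) //= big1 => [|i ik].
    by rewrite !mxE eqxx mulr1 addr0.
  by rewrite !mxE eq_sym (negbTE ik) mulr0.
have V2 := so_expand hV.
case: z => z /=; rewrite mxBE.
  rewrite [X in _ = _ + X]big1 ?addr0 => [|i _]; last by rewrite mulmx0 mul0mx subrr mxE mulr0.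
  rewrite {1 2}V2 mulmx_sumr mulmx_suml !summxE -sumrB; apply: eq_bigr => s _.
  by rewrite -scalemxAr -scalemxAl mxBE !mxZE mulrBr.
rewrite {1}V1 {1}V2 mulmx_sumr mulmx_suml !summxE addrC -sumrN; congr (_ + _).
  by apply: eq_bigr => i _; rewrite mul0mx subr0 -scalemxAr mxZE.
by apply: eq_bigr => s _; rewrite mulmx0 sub0r -scalemxAl mxZE mxNE mulrN.
Qed.

End Bracket.

(** * The hypotheses of the semidirect theorem for h_{p,q} *)

Section SoAffine.
Variables p q : nat.
Notation n := (p + q)%N.
Notation c := (h_c p q).
Notation S := (pairI n).
Notation T := 'I_n.

Lemma hc_anti u v w : c u v w = - c v u w.
Proof. by rewrite /h_c afbr_anti hCoordN. Qed.

Lemma is_so_hBasis u : is_so p (hBasis p u : afield n).2.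
Proof. by case: u => x; [exact: is_so_basis | exact: is_so0]. Qed.

Lemma is_so_afbr (V W : afield n) : is_so p V.2 -> is_so p W.2 -> is_so p (afbr V W).2.
Proof. by move=> hV hW; exact: is_so_comm. Qed.

Lemma hc_jacobi u v x z :
  \sum_w (c u v w * c w x z + c v x w * c w u z + c x u w * c w v z) = 0.
Proof.
have so u' v' := is_so_afbr (is_so_hBasis u') (is_so_hBasis v').
rewrite !big_split /= /h_c -!afbr_expand; try exact: so.
by rewrite -!hCoordD afbr_jacobi; case: z => z; rewrite /= mxE.
Qed.

Lemma hc_SST s t k : c (inl s) (inl t) (inr k) = 0.
Proof. by rewrite /h_c /= !mulmx0 subrr mxE. Qed.

Lemma hc_STS s i r : c (inl s) (inr i) (inl r) = 0.
Proof. by rewrite /h_c /= mul0mx mulmx0 subrr mxE. Qed.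

Lemma hc_TT i j w : c (inr i) (inr j) w = 0.
Proof. by case: w => w; rewrite /h_c /= !mul0mx subrr mxE. Qed.

Lemma hc_STT s i j : c (inl s) (inr i) (inr j) = - soBasis p s j i.
Proof.
rewrite /h_c /= mul0mx sub0r mxE; congr (- _).
rewrite mxE (bigD1 i) //= big1 => [|k ki]; first by rewrite mxE eqxx mulr1 addr0.
by rewrite mxE (negbTE ki) mulr0.
Qed.

Lemma hc_diag s i : c (inl s) (inr i) (inr i) = 0.
Proof.
rewrite hc_STT; have := is_so_basis p s i i.
by rewrite eta_sqr mul1r; lra.
Qed.

(** Cyclicity of the trace makes the trace form invariant, and [trace_basis] turns its values into
    structure constants. *)
Lemma hc_invariant s b r :
  pair_sign p s * c (inl s) (inl b) (inl r) +
  pair_sign p r * c (inl r) (inl b) (inl s) = 0.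
Proof.
have E t u : \tr ((soBasis p b *m soBasis p t - soBasis p t *m soBasis p b) *m soBasis p u) =
    - (pair_sign p u * c (inl t) (inl b) (inl u)) *+ 2.
  by rewrite trace_basis //; apply: is_so_comm; exact: is_so_basis.
have tr0 : \tr ((soBasis p b *m soBasis p s - soBasis p s *m soBasis p b) *m soBasis p r) +
   \tr ((soBasis p b *m soBasis p r - soBasis p r *m soBasis p b) *m soBasis p s) = 0.
  rewrite !mulmxBl !raddfB /= (mxtrace_mulC _ (soBasis p r)) mulmxA.
  rewrite (mxtrace_mulC (soBasis p s *m _)) mulmxA.
  rewrite (mxtrace_mulC (soBasis p r *m soBasis p s)) mulmxA.
  by ring.
have ss := pair_sign_sqr p s; have rr := pair_sign_sqr p r.
set x := c (inl s) _ _ in E *; set y := c (inl r) _ _ in E *.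
have : pair_sign p r * x + pair_sign p s * y = 0.
  by move: tr0; rewrite !E -/x -/y; lra.
(* Invariance of the form carries the two weights the other way round; multiplying by both, each of
   square 1, exchanges them. *)
move=> H; transitivity (pair_sign p s * (pair_sign p r * pair_sign p r) * x +
    pair_sign p r * (pair_sign p s * pair_sign p s) * y).
  by rewrite rr ss !mulr1.
transitivity (pair_sign p s * pair_sign p r * (pair_sign p r * x + pair_sign p s * y)).
  by ring.
by rewrite H mulr0.
Qed.

Lemma actX_so s (f : cochains R (S + T)%type) :
  actX c s f = pair_sign p s *: wedge R (inr (val s).2) (contr R (inr (val s).1) f) -
               wedge R (inr (val s).1) (contr R (inr (val s).2) f).
Proof.
have expand (a b : T) (x : R) (G : T -> T -> cochains R (S + T)%type) :
    \sum_i \sum_j (x * ((j == b) && (i == a))%:R) *: G i j = x *: G a b.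
  rewrite (bigD1 a) //= [X in _ + X]big1 ?addr0 => [|i /negPf ia]; last first.
    by rewrite big1 // => j _; rewrite ia andbF mulr0 scale0r.
  rewrite (bigD1 b) //= big1 => [|j /negPf jb]; last by rewrite jb mulr0 scale0r.
  by rewrite !eqxx mulr1 addr0.
rewrite /actX /Xop sum_lfunE.
transitivity (\sum_i \sum_j ((pair_sign p s * ((j == (val s).1) && (i == (val s).2))%:R) -
    1 * ((j == (val s).2) && (i == (val s).1))%:R) *: wedge R (inr i) (contr R (inr j) f)).
  apply: eq_bigr => i _; rewrite sum_lfunE; apply: eq_bigr => j _.
  by rewrite scale_lfunE mul_endE hc_STT soBasisE !mxE opprB mul1r.
under eq_bigr => i _ do (under eq_bigr => j _ do rewrite scalerBl; rewrite sumrB).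
rewrite sumrB.
by rewrite (expand _ _ _ (fun i j => wedge R (inr i) (contr R (inr j) f)))
  (expand _ _ 1 (fun i j => wedge R (inr i) (contr R (inr j) f))) scale1r.
Qed.

(** Replaces the covector y by x in a monomial. *)
Definition hop (J : finType) (x y : J) (f : cochains R J) : cochains R J :=
  wedge R x (contr R y f).

Lemma hop_hop (J : finType) (x y : J) f : x != y -> hop x y (hop x y f) = 0.
Proof.
move=> xy; apply/ffunP => A; rewrite [RHS]ffunE /hop wedgeE.
case: ifP => // xA; rewrite contrE /ins; case: ifP => _; rewrite ?mulr0 //.
by rewrite wedgeE !inE (negbTE xy) eqxx !mulr0.
Qed.

(** Replacing x by y and then y by x projects onto the monomials that contain x but not y; the signs
    occur in pairs and cancel. *)
Lemma hop_swap (J : finType) (x y : J) f (A : {set J}) : x != y ->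
  hop x y (hop y x f) A = ((x \in A) && (y \notin A))%:R * f A.
Proof.
move=> xy; rewrite /hop wedgeE; case: (boolP (x \in A)) => xA /=; last by rewrite mul0r.
rewrite contrE /ins !inE eq_sym (negbTE xy) /=.
case: (boolP (y \in A)) => yA /=; first by rewrite mulr0 mul0r.
rewrite wedgeE setU11 contrE /ins setU1K; last by rewrite !inE (negbTE yA) andbF.
rewrite !inE eqxx /= setD1K // mul1r -!/(sg R _ _).
rewrite (sgU R y) ?ltI_irr ?mul1r; last by rewrite !inE (negbTE yA) andbF.
rewrite (sgD R x xA) ltI_irr mul1r.
rewrite [X in _ * X]mulrA sg_sqr mul1r mulrA sg_sqr mul1r.
by [].
Qed.

(** In the square of X_s the two squared replacements vanish, and the cross terms project onto
    monomials containing exactly one of the two indices. The eigenvalue thus counts the pairs split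
    by the [T] part, j(n - j) of them if it has j elements. *)
Lemma casimir_so (f : cochains R (S + T)%type) A :
  (\sum_(s : S) pair_sign p s *: actX c s (actX c s f)) A =
  - ((\sum_(s : S) ((inr (val s).1 \in A) != (inr (val s).2 \in A))%:R) * f A).
Proof.
rewrite sum_ffunE mulr_suml -sumrN; apply: eq_bigr => s _.
set x : S + T := inr (val s).1; set y : S + T := inr (val s).2.
have xy : x != y by rewrite (inj_eq (@inr_inj _ _)) pair_neq.
have yx : y != x by rewrite eq_sym.
set e := pair_sign p s; have ee : e * e = 1 by exact: pair_sign_sqr.
have casE g : actX c s g = e *: hop y x g - hop x y g by exact: actX_so.
have hopZ u v (a : R) g h : hop u v (a *: g - h) = a *: hop u v g - hop u v h :> cochains R (S + T)%type.
  by rewrite /hop !linearB !linearZ.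
rewrite !casE !hopZ !hop_hop // scaler0 sub0r subr0 !ffunE !hop_swap //.
by case: (x \in A); case: (y \in A);
  rewrite /= ?(mul0r, mul1r, oppr0, scaler0, subr0, sub0r) ?scalerN ?scalerA ?ee ?scale1r.
Qed.

Lemma lam_so_eq0 (A : {set S + T}) :
  \sum_(s : S) ((inr (val s).1 \in A) != (inr (val s).2 \in A))%:R = 0 :> R ->
  trivial_set (rpart A).
Proof.
rewrite -natr_sum => /eqP; rewrite pnatr_eq0 sum_nat_eq0 => /forallP h.
have hlt (i j : T) : (i < j)%N -> (inr i \in A) = (inr j \in A).
  move=> ij; have := h (Sub (i, j) ij); rewrite /= eqb0 negbK.
  by move/eqP.
have all_eq i j : (i \in rpart A) = (j \in rpart A).
  by rewrite !inE; case: (ltngtP i j) => [/hlt|/hlt|/val_inj ->].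
rewrite /trivial_set; have [//|[i iA]] := set_0Vmem (rpart A).
  by move=> ->; rewrite eqxx.
apply/orP; right; apply/eqP/setP => j; rewrite in_setT.
by rewrite (all_eq j i) iA.
Qed.

End SoAffine.

(** Finite-dimensional graded spaces are isomorphic exactly when their dimensions agree in every
    degree. Tensoring with a line in degree 0 plus a line in degree n adds a copy shifted by n. *)
Theorem theorem6p2 (p q : nat) :
  (4 <= p + q)%N ->
  forall k : nat,
    Hdim (h_c p q) k =
    (Hdim (so_c p q) k +
     (if (p + q <= k)%N then Hdim (so_c p q) (k - (p + q)) else 0))%N.
Proof.
move=> pq k; have n_gt0 : (0 < #|'I_(p + q)|)%N by rewrite card_ord (leq_trans _ pq).
have := Hdim_semidirect (@hc_anti p q) (@hc_jacobi p q) (@hc_SST p q) (@hc_STS p q)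
  (@hc_TT p q) (@hc_diag p q) (@hc_invariant p q) (@casimir_so p q) (@lam_so_eq0 p q) n_gt0 k.
by rewrite card_ord.
Qed.
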